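(* Let $\rho$ be a primitive third root of unity and let $\gamma,\beta\in\mathbb{Z}[\rho]$. For all $a,c\in\mathbb{Z}[\rho]$, the elements $$Y=a^3\gamma-\rho\beta c^3,\quad X_1=a^3\gamma-\rho^2\beta c^3,\quad X_2=\gamma(1-\rho)a^2c,\quad X_3=(1-\rho)ac^2$$ of $\mathbb{Z}[\rho]$ satisfy $$\gamma Y^3=\gamma X_1^3+\beta X_2^3+\gamma^2\beta^2X_3^3 .$$
   Context: $\mathbb{Z}[\rho]$ is the ring of integers of $\mathbb{Q}[\rho]$. *)

(* Defs.v *)
From HB Require Import structures.
From mathcomp Require Import all_boot all_order all_algebra all_field.
From mathcomp Require Import ring.

Set Implicit Arguments.
Unset Strict Implicit.
Unset Printing Implicit Defensive.

Import Order.TTheory GRing.Theory Num.Theory.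

Local Open Scope ring_scope.

(* S[x]: the values at x of the polynomials with coefficients in S.  In
   particular Z[x] is [adjoin Num.int x] and Q[x] is [adjoin Crat x]. *)
Definition adjoin (S : {pred algC}) (x z : algC) : Prop :=
  exists2 p : {poly algC}, p \is a polyOver S & z = p.[x].

Lemma prim3_root_eq (rho : algC) :
  3.-primitive_root rho -> rho ^+ 2 = - 1 - rho.
Proof.
move=> prho; have rho3 := prim_expr_order prho.
have rho_neq1 : rho - 1 != 0.
  by rewrite subr_eq0; have := eq_prim_root_expr prho 1 0; rewrite expr1 => ->.
apply/eqP; rewrite -subr_eq0; apply/eqP; apply: (mulfI rho_neq1).
rewrite mulr0; transitivity (rho ^+ 3 - 1); first by ring.
by rewrite rho3 subrr.
Qed.

Lemma adjoin_prim3P (S : subringClosed algC) (rho z : algC) :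
  3.-primitive_root rho ->
  adjoin S rho z <->
  exists x y : algC, [/\ x \in S, y \in S & z = x + y * rho].
Proof.
move=> /prim3_root_eq rho2; split=> [[p /polyOverP Sp ->] | [x [y [Sx Sy ->]]]].
  have powP i : exists x y, [/\ x \in S, y \in S & rho ^+ i = x + y * rho].
    elim: i => [|i [x [y [Sx Sy IHi]]]].
      by exists 1, 0; rewrite rpred0 rpred1 mul0r addr0.
    exists (- y), (x - y); rewrite rpredN rpredB //; split=> //.
    rewrite exprS IHi mulrDr mulrCA -expr2 rho2; ring.
  rewrite horner_coef; elim/big_ind: _ => [|u v | i _].
  - by exists 0, 0; rewrite rpred0 mul0r addr0.
  - move=> [x [y [Sx Sy ->]]] [x' [y' [Sx' Sy' ->]]].
    by exists (x + x'), (y + y'); rewrite !rpredD //; split=> //; ring.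
  - have [x [y [Sx Sy ->]]] := powP i.
    by exists (p`_i * x), (p`_i * y); rewrite !rpredM //; split=> //; ring.
exists (x%:P + y *: 'X); last by rewrite !hornerE.
by rewrite rpredD ?polyOverC // polyOverZ ?polyOverX.
Qed.

(* Z[rho] is the ring of integers of Q[rho]. *)
Lemma adjoin_int_prim3 (rho z : algC) : 3.-primitive_root rho ->
  adjoin Num.int rho z <-> adjoin Crat rho z /\ z \in Aint.
Proof.
move=> prho; have rho2 := prim3_root_eq prho.
split=> [/(adjoin_prim3P _ _ prho) [x [y [Zx Zy ->]]] | []].
  split; last by rewrite rpredD ?rpredM ?(Aint_prim_root prho) ?(Aint_Cint Zx) ?(Aint_Cint Zy).
  by apply/(adjoin_prim3P _ _ prho); exists x, y; split=> //; apply: rpred_int_num.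
move=> /(adjoin_prim3P _ _ prho) [x [y [Qx Qy Dz]]] Az.
have conj_rho : rho^* = - 1 - rho.
  have rho3 := prim_expr_order prho.
  have norm_rho : `|rho| = 1.
    by apply/eqP; rewrite -(@pexpr_eq1 _ _ 3) // -normrX rho3 normr1.
  have rhoK : rho * rho^* = 1 by rewrite -normCK norm_rho expr1n.
  by rewrite -rho2 -[LHS]mul1r -rho3 exprSr -mulrA rhoK mulr1.
have Az' : x + y * (- 1 - rho) \in Aint.
  have: z^* \in Aint by rewrite Aint_aut.
  by rewrite Dz rmorphD rmorphM /= (conj_Crat Qx) (conj_Crat Qy) conj_rho.
rewrite Dz in Az; have Arho := Aint_prim_root prho.
have Zm : 2 * x - y \in Num.int.
  apply: Cint_rat_Aint; first by rewrite rpredB ?rpredM ?rpred_nat.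
  rewrite (_ : _ - _ = x + y * rho + (x + y * (- 1 - rho))); last by ring.
  exact: rpredD.
have Zn : 2 * y - x \in Num.int.
  apply: Cint_rat_Aint; first by rewrite rpredB ?rpredM ?rpred_nat.
  rewrite (_ : _ - _ = (x + y * rho) * (- 1 - rho)
                       + (x + y * (- 1 - rho)) * rho).
    have ? : - 1 - rho \in Aint by rewrite rpredB // rpredN1.
    by apply: rpredD; apply: rpredM.
  transitivity (- x - 2 * y * rho - 2 * y * rho ^+ 2); last by ring.
  by rewrite rho2; ring.
have Zk : x ^+ 2 - x * y + y ^+ 2 \in Num.int.
  apply: Cint_rat_Aint; first by rewrite rpredD ?rpredB ?rpredX ?rpredM.
  rewrite (_ : _ + _ = (x + y * rho) * (x + y * (- 1 - rho))).
    exact: rpredM.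
  transitivity (x ^+ 2 - x * y - y ^+ 2 * rho - y ^+ 2 * rho ^+ 2).
    by rewrite rho2; ring.
  by ring.
(* With u := x - y, both 3 * u and 3 * u ^+ 2 are integers, so u is one. *)
have /intrP[b Db] : 3 * (x - y) \in Num.int.
  rewrite (_ : _ * _ = 2 * x - y - (2 * y - x)); last by ring.
  exact: rpredB.
have /intrP[j Dj] : 3 * (x - y) ^+ 2 \in Num.int.
  rewrite (_ : _ * _ = x ^+ 2 - x * y + y ^+ 2 - (2 * x - y) * (2 * y - x)).
    by apply: rpredB => //; apply: rpredM.
  by ring.
have Eb : b ^+ 2 = 3 * j.
  apply: (@intr_inj algC); rewrite rmorphXn rmorphM /= -Db -Dj.
  by ring.
have /dvdzP[d Dd] : (3 %| b)%Z.
  have: (3 %| b ^+ 2)%Z by rewrite Eb dvdz_mulr.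
  by rewrite !dvdzE abszX Euclid_dvdX // => /andP[].
have Zu : x - y \in Num.int.
  suff -> : x - y = d%:~R by rewrite intr_int.
  apply: (@mulfI _ (3 : algC)); first by rewrite pnatr_eq0.
  by rewrite Db Dd rmorphM /= mulrC.
apply/(adjoin_prim3P _ _ prho); exists x, y; split=> //.
  have -> : x = 2 * x - y - (x - y) by ring.
  exact: rpredB.
have -> : y = 2 * y - x + (x - y) by ring.
exact: rpredD.
Qed.

(* Main.v *)
Require Import Defs.
From mathcomp Require Import all_boot all_order all_algebra all_field.
From mathcomp Require Import ring.

(** With A = a^3 gamma and B = beta c^3 one has Y = A - rho B and
    X1 = A - rho^2 B, and the claim is that gamma (Y^3 - X1^3) is the sum of
    the last two terms.  Since rho is a primitive cube root of unity,
    Y^3 - X1^3 is the product of the three factors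
      Y - X1       = - rho (1 - rho) B,
      Y - rho X1   = (1 - rho) (A + B),
      Y - rho^2 X1 = - rho^2 (1 - rho) A,
    that is, (1 - rho)^3 A B (A + B) ([sub_cube_prim3]).  Multiplied by gamma,
    its A^2 B part is beta X2^3 and its A B^2 part is gamma^2 beta^2 X3^3.
    The four elements lie in Z[rho] because Z[rho] is a ring containing rho. *)

Import Order.TTheory GRing.Theory Num.Theory.

Local Open Scope ring_scope.

Section AdjoinRing.

Variables (S : subringClosed algC) (x : algC).

Lemma adjoin_gen : adjoin S x x.
Proof. by exists 'X; rewrite ?polyOverX ?hornerX. Qed.

Lemma adjoin1 : adjoin S x 1.
Proof. by exists 1; rewrite ?rpred1 ?hornerE. Qed.

Lemma adjoinB u v : adjoin S x u -> adjoin S x v -> adjoin S x (u - v).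
Proof.
by move=> [p Sp ->] [q Sq ->]; exists (p - q); rewrite ?rpredB ?hornerE.
Qed.

Lemma adjoinM u v : adjoin S x u -> adjoin S x v -> adjoin S x (u * v).
Proof.
by move=> [p Sp ->] [q Sq ->]; exists (p * q); rewrite ?rpredM ?hornerE.
Qed.

Lemma adjoinX u n : adjoin S x u -> adjoin S x (u ^+ n).
Proof. by move=> [p Sp ->]; exists (p ^+ n); rewrite ?rpredX ?horner_exp. Qed.

End AdjoinRing.

Lemma sub_cube_prim3 (R : comPzRingType) (r A B : R) :
  r ^+ 2 = - 1 - r ->
  (A - r * B) ^+ 3 - (A - r ^+ 2 * B) ^+ 3 = (1 - r) ^+ 3 * (A * B * (A + B)).
Proof.
move=> r2; have r_cyclo : 1 + r + r ^+ 2 = 0 by rewrite r2; ring.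
apply/eqP; rewrite -subr_eq0; apply/eqP.
(* As polynomials in r, A and B, the two sides differ by a multiple of the
   third cyclotomic polynomial 1 + r + r^2; this is the cofactor. *)
transitivity ((1 + r + r ^+ 2) * ((1 - r) *
  ((3 * r - 1) * A * B ^+ 2 - A ^+ 2 * B - r ^+ 3 * B ^+ 3))); first by ring.
by rewrite r_cyclo mul0r.
Qed.

Theorem mainTheorem2 (rho : algC) (hrho : 3.-primitive_root rho)
    (gamma beta : algC)
    (hgamma : adjoin Num.int rho gamma) (hbeta : adjoin Num.int rho beta) :
  forall a c : algC, adjoin Num.int rho a -> adjoin Num.int rho c ->
  let Y := a ^+ 3 * gamma - rho * beta * c ^+ 3 in
  let X1 := a ^+ 3 * gamma - rho ^+ 2 * beta * c ^+ 3 in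
  let X2 := gamma * (1 - rho) * a ^+ 2 * c in
  let X3 := (1 - rho) * a * c ^+ 2 in
  [/\ adjoin Num.int rho Y, adjoin Num.int rho X1,
      adjoin Num.int rho X2, adjoin Num.int rho X3 &
      gamma * Y ^+ 3 =
        gamma * X1 ^+ 3 + beta * X2 ^+ 3 + gamma ^+ 2 * beta ^+ 2 * X3 ^+ 3].
Proof.
move=> a c Za Zc Y X1 X2 X3.
have Zrho : adjoin Num.int rho rho := adjoin_gen _ rho.
have Z1 : adjoin Num.int rho 1 := adjoin1 _ rho.
split; try by rewrite /Y /X1 /X2 /X3; repeat
  first [assumption | apply: adjoinB | apply: adjoinM | apply: adjoinX].
have := sub_cube_prim3 _ rho (a ^+ 3 * gamma) (beta * c ^+ 3)
          (prim3_root_eq hrho).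
rewrite (mulrA rho) (mulrA (rho ^+ 2)) -/Y -/X1 => /(canRL (subrK _)) ->.
by rewrite /X2 /X3; ring.
Qed.
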